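(* If $(g_1(p)-p)/(g_2(p)-p)$ increases for $p\in(0,1)$, then deductible insurance is optimal, that is, $$f^*(x)=(x-d)_+$$ is optimal with the deductible $d$ given by $$d=\inf\left\{t:\ \frac{g_1(S_X(t))-S_X(t)}{g_2(S_X(t))-S_X(t)}\le\frac{\theta-b_1}{\theta(1+b_1)}\right\}.$$ If no such $d$ exists, then $f^*\equiv 0$ is optimal.
   Context: Let $(\Omega,\mathcal{F},\mathbb{P})$ be a probability space. For an almost surely finite random variable $Y$ let $S_Y(t)=\mathbb{P}(Y>t)$. A concave distortion is a non-decreasing concave function $g:[0,1]\to[0,1]$ with $g(0)=0$, $g(1)=1$; its distortion risk measure is $H_g(Y)=\int_{-\infty}^0(g[S_Y(t)]-1)\,dt+\int_0^\infty g[S_Y(t)]\,dt$. An individual (agent 2) faces a random loss $X\ge 0$ and may buy insurance from an insurer (agent 1, with initial loss $0$). The concave distortions of insurer and buyer are $g_1$ and $g_2$, with $g_2\ge g_1$ (and $g_2(p)>p$ on $(0,1)$, so that the ratio in the claim is defined); $H_{g_2}(X)$ is assumed finite. There are constants $0<b_1<\theta$. The preference functionals (to be minimized) are $$V_1(Y)=(1+b_1)H_{g_1}(Y)-(1+\theta)\,\mathbb{E}Y,\qquad V_2(Y)=H_{g_2}(Y)-(1+\theta)\,\mathbb{E}Y.$$ An allocation is a pair $(Y_1,Y_2)$ with $Y_1+Y_2=X$ and $V_1(Y_1),V_2(Y_2)$ finite. It is Pareto optimal if any allocation $(Z_1,Z_2)$ with $V_i(Z_i)\le V_i(Y_i)$,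 $i=1,2$, satisfies $V_i(Z_i)=V_i(Y_i)$, $i=1,2$. The insurance (indemnity) function $f^*$, normalized by $f^*(0)=0$, is called optimal if the allocation $(f^*(X),X-f^*(X))$ is Pareto optimal; $f^*(X)$ is the part of the loss paid by the insurer. ''Increases'' is meant in the weak sense (non-decreasing). The infimum is over $t\ge 0$ for which the ratio is defined (i.e. $0<S_X(t)<1$); ''no such $d$ exists'' means this set is empty. *)

(* Defs.v *)
From HB Require Import structures.
From mathcomp Require Import all_boot all_order all_algebra.
From mathcomp Require Import all_classical all_reals all_analysis.
From mathcomp Require Import measurable_realfun.
Set Implicit Arguments.
Unset Strict Implicit.
Unset Printing Implicit Defensive.
Import Order.TTheory GRing.Theory Num.Theory.
Import numFieldNormedType.Exports.
Local Open Scope classical_set_scope.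
Local Open Scope ring_scope.

(* The conditions concern the restriction of [g] to [0, 1] only; the values of
   [g] elsewhere are junk and never matter, since a survival probability lies
   in [0, 1].  Concavity of [g] is convexity of [- g]. *)
Definition concave_distortion (R : realType) (g : R -> R) : Prop :=
  [/\ {in `[0, 1], forall p, g p \in `[0, 1]},
      {in `[0, 1] &, {homo g : p q / p <= q}},
      convex_function (`[0, 1]%classic : set R) (\- g),
      g 0 = 0 & g 1 = 1].

Section risk.
Context {d : measure_display} {T : measurableType d} {R : realType}.
Variable P : probability T R.

Definition survival (Y : {RV P >-> R}) (t : R) : R := fine (ccdf Y t).

(* For a distortion [g], the first integral lies in [-oo, 0] and the second one
   in [0, +oo], so the sum is finite iff both are: the convention
   [+oo + -oo = -oo] never produces a spurious finite value.  The same holds for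
   [V1] and [V2] below (with [1 + b1] and [1 + theta] positive) and for the
   expectation, which is finite iff [Y] is integrable. *)
Definition distortion_risk (g : R -> R) (Y : {RV P >-> R}) : \bar R :=
  (\int[lebesgue_measure]_(t in `]-oo, 0%R[) (g (survival Y t) - 1)%:E +
   \int[lebesgue_measure]_(t in `[0%R, +oo[) (g (survival Y t))%:E)%E.

Definition V1 (g1 : R -> R) (b1 theta : R) (Y : {RV P >-> R}) : \bar R :=
  ((1 + b1)%:E * distortion_risk g1 Y - (1 + theta)%:E * 'E_P[Y])%E.

Definition V2 (g2 : R -> R) (theta : R) (Y : {RV P >-> R}) : \bar R :=
  (distortion_risk g2 Y - (1 + theta)%:E * 'E_P[Y])%E.

(* Equality of random variables is almost sure. *)
Definition allocation (U1 U2 : {RV P >-> R} -> \bar R)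
    (X Y1 Y2 : {RV P >-> R}) : Prop :=
  [/\ {ae P, forall w, Y1 w + Y2 w = X w},
      U1 Y1 \is a fin_num & U2 Y2 \is a fin_num].

Definition pareto_optimal (U1 U2 : {RV P >-> R} -> \bar R)
    (X Y1 Y2 : {RV P >-> R}) : Prop :=
  allocation U1 U2 X Y1 Y2 /\
  forall Z1 Z2 : {RV P >-> R}, allocation U1 U2 X Z1 Z2 ->
    (U1 Z1 <= U1 Y1)%E -> (U2 Z2 <= U2 Y2)%E ->
    U1 Z1 = U1 Y1 /\ U2 Z2 = U2 Y2.

Definition optimal_indemnity (U1 U2 : {RV P >-> R} -> \bar R)
    (X : {RV P >-> R}) (f : {mfun R >-> R}) : Prop :=
  f 0 = 0 /\ pareto_optimal U1 U2 X (f \o X) (X \- (f \o X)).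

End risk.

Definition deductible {R : realType} (d x : R) : R := Num.max (x - d) 0.

Lemma measurable_deductible (R : realType) (d : R) :
  measurable_fun [set: R] (deductible d).
Proof.
by apply: measurable_maxr => //; apply: measurable_funB.
Qed.

HB.instance Definition _ (R : realType) (d : R) :=
  isMeasurableFun.Build _ _ R R (deductible d) (measurable_deductible d).

(* Main.v *)
Require Import Defs.
From HB Require Import structures.
From mathcomp Require Import all_boot all_order all_algebra.
From mathcomp Require Import all_classical all_reals all_analysis.
From mathcomp Require Import measurable_realfun.
From mathcomp Require Import ring lra.
Set Implicit Arguments.
Unset Strict Implicit.
Unset Printing Implicit Defensive.
Import Order.TTheory GRing.Theory Num.Theory.
Import numFieldNormedType.Exports.
Local Open Scope classical_set_scope.
Local Open Scope ring_scope.

(** Write [excess g p = g p - p] and, for a function [h] on [[0, 1]], let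
    [deviation h Y] be the integral over the whole line of [h (S_Y t)]. For
    integrable [Y] one has [H_g Y = E Y + deviation (excess g) Y]
    ([distortion_riskE]), since the mean is the distortion risk of the
    identity.

    The two agents trade cash at opposite rates: a constant [c] added to the
    loss of the insurer changes [V1] by [(b1 - theta) c], and the same
    constant removed from the loss of the buyer changes [V2] by [theta c]. Up
    to scale, the only weights for which the total is insensitive to such
    transfers are [theta] for [V1] and [theta - b1] for [V2], and with them
    all the means collect into [E X]: [theta V1(Y1) + (theta - b1) V2(Y2)] is,
    up to a constant depending only on [X], the sum [a D1(Y1) + c D2(Y2)]
    where [a = theta (1 + b1)], [c = theta - b1] and [Di] is the deviation of
    [excess gi]. Since both weights are positive, an allocation that minimises
    this sum is Pareto optimal.

    A lower bound for the sum comes from the concave function [m = min (a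
    excess g1, c excess g2)]: any allocation has [a D1(Y1) + c D2(Y2) >=
    deviation m Y1 + deviation m Y2 >= deviation m X], the last step being the
    subadditivity of the deviation of a concave function vanishing at [0] and
    [1] ([deviation_subadditive]). The bound is attained when each layer [t]
    of the loss is held by the agent for whom it is cheaper, and a deductible
    [x] gives the layers below [x] to the buyer and those above to the
    insurer. As [S_X] decreases, the monotonicity of the ratio [excess g1 /
    excess g2] means that the insurer becomes the cheaper holder at most once,
    at the infimum that defines the deductible.

    Subadditivity is proved without densities or comonotonicity. For the tent
    [p |-> min (p (1 - s), s (1 - p))] the deviation of [Y] is the minimum
    over [x] of the expected pinball loss of [Y - x], attained at a quantile
    ([tent_deviation_le], [tent_deviation_quantile]); the pinball loss is
    subadditive, hence so is the deviation. The polygon inscribed in a concave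
    [h] is a nonnegative combination of tents, the tents being the Green
    functions of the second difference ([polygonE]). Polygons lie below [h]
    and converge to it, so the lemma of Fatou passes to the limit. *)

(** * Concave functions vanishing at both ends of the unit interval *)

Lemma eqW {disp : Order.disp_t} {T : porderType disp} (x y : T) :
  x = y -> (x <= y)%O.
Proof. by move=> ->. Qed.

Definition concave_bump {R : realType} (h : R -> R) : Prop :=
  [/\ h 0 = 0, h 1 = 0 &
      forall p q t : R, 0 <= p <= 1 -> 0 <= q <= 1 -> 0 <= t <= 1 ->
        t * h p + (1 - t) * h q <= h (t * p + (1 - t) * q)].

(** The identity is the distortion whose risk measure is the mean. *)
Definition excess {R : realType} (g : R -> R) (p : R) : R := g p - p.

Section concave_bumps.
Context {R : realType}.
Implicit Types (h g : R -> R) (p q s t : R).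

(** The graph lies above the chord joining its two zeros. *)
Lemma concave_bump_ge0 h p : concave_bump h -> 0 <= p <= 1 -> 0 <= h p.
Proof.
case=> h0 h1 hc /[dup] p01 /andP[p0 p1].
have := hc 1 0 p; rewrite h0 h1 !mulr0 addr0 mulr1 addr0; apply => //; lra.
Qed.

Lemma concave_bump_min h g : concave_bump h -> concave_bump g ->
  concave_bump (fun p => Num.min (h p) (g p)).
Proof.
move=> [h0 h1 hc] [g0 g1 gc]; split; rewrite ?h0 ?h1 ?g0 ?g1 ?minxx// => p q t.
move=> p01 q01 t01; rewrite le_min; apply/andP.
have /andP[t0 t1] := t01.
split; [apply: le_trans (hc p q t p01 q01 t01)|
  apply: le_trans (gc p q t p01 q01 t01)].
  by apply: lerD; apply: ler_wpM2l; rewrite ?subr_ge0// ge_min lexx.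
by apply: lerD; apply: ler_wpM2l; rewrite ?subr_ge0// ge_min lexx orbT.
Qed.

Lemma concave_bumpZ (a : R) h : 0 <= a -> concave_bump h ->
  concave_bump (fun p => a * h p).
Proof.
move=> a0 [h0 h1 hc]; split; rewrite ?h0 ?h1 ?mulr0// => p q t p01 q01 t01.
have := ler_wpM2l a0 (hc p q t p01 q01 t01); rewrite mulrDr.
by rewrite !(mulrCA a).
Qed.

Lemma distortion_bump g : concave_distortion g ->
  concave_bump (excess g).
Proof.
case=> _ _ gc g0 g1; rewrite /excess; split.
- by rewrite g0 subrr.
- by rewrite g1 subrr.
move=> p q t p01 q01 t01.
have /andP[t0 t1] := t01.
have pE : p \in `[0, 1]%classic by rewrite inE/= in_itv.
have qE : q \in `[0, 1]%classic by rewrite inE/= in_itv.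
have ti01 : Itv.spec (@Itv.num_sem R) (Itv.Real `[0%Z, 1%Z]) t.
  by rewrite /= /Itv.num_sem /= num_real in_itv/= t0 t1.
have := gc (Itv.mk ti01) p q pE qE.
rewrite !convRE/= /unstable.onem -subr_ge0 => H; rewrite -subr_ge0.
by apply: le_trans H _; apply: eqW; ring.
Qed.

(** A quantitative lower semicontinuity: the chords from [p] to the two zeros
    lie below the graph, so that near [p] the function can only drop by a
    factor controlled by the distance of [p] to the ends, uniformly in [h]. *)
Lemma concave_bump_near_ge h p q (e : R) : concave_bump h -> 0 < p < 1 ->
  0 <= q <= 1 -> `|p - q| <= e -> h p * (1 - e / (p * (1 - p))) <= h q.
Proof.
move=> hb /andP[p0 p1] /andP[q0 q1] pqe.
have hp : 0 <= h p by apply: concave_bump_ge0 => //; lra.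
have p1' : 0 < 1 - p by lra.
have pp : 0 < p * (1 - p) by rewrite mulr_gt0.
case: hb => h0 h1 hc.
have [qp|pq] := leP q p.
  have := hc p 0 (q / p) ltac:(lra) ltac:(lra).
  rewrite h0 !mulr0 !addr0 divfK ?gt_eqF// => H.
  apply: le_trans (H _); last first.
    by rewrite divr_ge0 ?(ltW p0)//= ler_pdivrMr// mul1r.
  rewrite mulrC ler_wpM2r//.
  rewrite ler_pdivlMr// mulrBl mul1r lerBlDl -lerBlDr.
  have E : e / (p * (1 - p)) * p = e / (1 - p).
    by field; rewrite (gt_eqF p0)/= (gt_eqF p1').
  rewrite E ler_pdivlMr//; move: pqe; rewrite ger0_norm; nra.
have := hc p 1 ((1 - q) / (1 - p)) ltac:(lra) ltac:(lra).
rewrite h1 !mulr0 !addr0 !mulr1.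
have -> : (1 - q) / (1 - p) * p + (1 - (1 - q) / (1 - p)) = q.
  by field; rewrite (gt_eqF p1').
move=> H; apply: le_trans (H _); last first.
  by rewrite divr_ge0 ?subr_ge0 ?(ltW p1)//= ler_pdivrMr// mul1r; lra.
rewrite mulrC ler_wpM2r//.
rewrite ler_pdivlMr// mulrBl mul1r lerBlDl -lerBlDr.
have E : e / (p * (1 - p)) * (1 - p) = e / p.
  by field; rewrite (gt_eqF p0)/= (gt_eqF p1').
rewrite E ler_pdivlMr//; move: pqe; rewrite ltr0_norm; nra.
Qed.

End concave_bumps.

(** * Inscribed polygons as combinations of tents *)

(** The Green function of the second difference on [[0, 1]], with its kink at
    [s]. *)
Definition tent {R : realType} (s p : R) : R :=
  Num.min (p * (1 - s)) (s * (1 - p)).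

Definition node {R : realType} (m k : nat) : R := k%:R / m.+1%:R.

(** Minus the second difference of [h] at the node [k.+1]. *)
Definition bend {R : realType} (m : nat) (h : R -> R) (k : nat) : R :=
  2 * h (node m k.+1) - h (node m k) - h (node m k.+2).

(** The polygon inscribed in [h] at the nodes, for [h] vanishing at [0] and
    [1]; this form displays it as a combination of tents, [polygonE] gives the
    interpolation formula. *)
Definition polygon {R : realType} (m : nat) (h : R -> R) (p : R) : R :=
  \sum_(0 <= k < m) (m.+1%:R * bend m h k) * tent (node m k.+1) p.

Section polygons.
Context {R : realType}.
Implicit Types (h g : R -> R) (p q s t : R).

Lemma tent_ge0 s p : 0 <= s <= 1 -> 0 <= p <= 1 -> 0 <= tent s p.
Proof.
by move=> /andP[s0 s1] /andP[p0 p1]; rewrite le_min !mulr_ge0// subr_ge0.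
Qed.

Lemma node_itv m k : (k <= m.+1)%N -> 0 <= (node m k : R) <= 1.
Proof.
by move=> km; rewrite /node divr_ge0//= ler_pdivrMr ?ltr0n// mul1r ler_nat.
Qed.

Lemma node0 m : node m 0 = 0 :> R.
Proof. by rewrite /node mul0r. Qed.

Lemma node1 m : node m m.+1 = 1 :> R.
Proof. by rewrite /node divff. Qed.

Lemma bend_ge0 m h k : concave_bump h -> (k < m)%N -> 0 <= bend m h k.
Proof.
move=> [_ _ hc] km.
have H := hc (node m k) (node m k.+2) (1 / 2)
  (node_itv (leqW (ltnW km))) (node_itv (km : (k.+2 <= m.+1)%N)).
have E : 1 / 2 * node m k + (1 - 1 / 2) * node m k.+2 = node m k.+1 :> R.
  by rewrite /node -!natr1; field; rewrite ?(addrC 1) ?natr1 pnatr_eq0.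
rewrite E in H.
have {H} := H ltac:(lra); rewrite /bend; lra.
Qed.

Lemma natr_tent_node m k p :
  m.+1%:R * tent (node m k) p = Num.min (p * (m.+1%:R - k%:R)) (k%:R * (1 - p)).
Proof.
rewrite /tent minr_pMr ?ler0n// /node; congr Num.min.
  by field; rewrite ?(addrC 1) ?natr1 pnatr_eq0.
by field; rewrite ?(addrC 1) ?natr1 pnatr_eq0.
Qed.

(** On the cell of [p] the tents with node to the left of [p] contribute
    multiples of [1 - p], those to the right multiples of [p]; both families
    of coefficients are summed by parts. *)
Lemma polygonE m h j p : h 0 = 0 -> h 1 = 0 -> (j <= m)%N ->
  node m j <= p <= node m j.+1 ->
  polygon m h p = h (node m j) * (j.+1%:R - p * m.+1%:R) +
                  h (node m j.+1) * (p * m.+1%:R - j%:R).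
Proof.
move=> h0 h1 jm /andP[].
have n0 : 0 < m.+1%:R :> R by rewrite ltr0n.
rewrite [in X in X -> _]/node ler_pdivrMr// => jp.
rewrite [in X in X -> _]/node ler_pdivlMr// => pj.
rewrite /polygon (big_cat_nat (leq0n j) jm)//=.
(* The telescoping primitives: [v k.+1 - v k = k.+1 * bend k] and
   [w k - w k.+1 = (m - k) * bend k]. *)
pose v k : R := k.+1%:R * h (node m k) - k%:R * h (node m k.+1).
pose w k : R := (m.+1%:R - k%:R) * h (node m k.+1) -
                (m.+1%:R - k.+1%:R) * h (node m k).
have -> : \sum_(0 <= k < j) (m.+1%:R * bend m h k) * tent (node m k.+1) p =
          (1 - p) * v j.
  transitivity (\sum_(0 <= k < j) ((1 - p) * v k.+1 - (1 - p) * v k)).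
    apply: eq_big_nat => k /andP[_ kj].
    rewrite mulrAC natr_tent_node min_r; last first.
      have : k.+1%:R <= p * m.+1%:R by apply: le_trans jp; rewrite ler_nat.
      by move=> ?; rewrite !mulrBr !mulr1; lra.
    by rewrite /v /bend -!natr1; ring.
  by rewrite telescope_sumr// /v node0 h0 mulr0 mul0r subr0 mulr0 subr0.
have -> : \sum_(j <= k < m) (m.+1%:R * bend m h k) * tent (node m k.+1) p =
          p * w j.
  transitivity (\sum_(j <= k < m) (- (p * w k.+1) - - (p * w k))).
    apply: eq_big_nat => k /andP[jk _].
    rewrite mulrAC natr_tent_node min_l; last first.
      have : p * m.+1%:R <= k.+1%:R by apply: le_trans pj _; rewrite ler_nat.
      by move=> ?; rewrite !mulrBr !mulr1; lra.
    by rewrite /w /bend -!natr1; ring.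
  rewrite telescope_sumr// /w node1 h1 mulr0 subrr mul0r subr0 mulr0 oppr0.
  by rewrite sub0r opprK.
by rewrite /v /w -!natr1; ring.
Qed.

Lemma ex_node m p : 0 <= p <= 1 ->
  exists2 j, (j <= m)%N & node m j <= p <= (node m j.+1 : R).
Proof.
have n0 : 0 < m.+1%:R :> R by rewrite ltr0n.
move=> /andP[p0]; rewrite le_eqVlt => /predU1P[->|p1].
  exists m => //; rewrite node1 lexx andbT.
  by have /andP[] := @node_itv m m (leqnSn m).
have /truncn_itv/andP[jl ju] : 0 <= p * m.+1%:R by rewrite mulr_ge0.
exists (Num.truncn (p * m.+1%:R)).
  rewrite -ltnS -(ltr_nat R); apply: le_lt_trans jl _.
  by rewrite gtr_pMl.
by rewrite /node ler_pdivrMr// jl ler_pdivlMr// ltW.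
Qed.

Lemma polygon_le m h p : concave_bump h -> 0 <= p <= 1 -> polygon m h p <= h p.
Proof.
move=> [h0 h1 hc] /(ex_node m)[j jm /[dup] pj /andP[]].
have n0 : 0 < m.+1%:R :> R by rewrite ltr0n.
rewrite (polygonE h0 h1 jm pj).
rewrite /node ler_pdivrMr// ler_pdivlMr// -/(node m j) -/(node m j.+1) => jl ju.
have := hc (node m j) (node m j.+1) (j.+1%:R - p * m.+1%:R)
  (node_itv (leqW jm)) (node_itv (jm : (j.+1 <= m.+1)%N)).
have -> : (j.+1%:R - p * m.+1%:R) * node m j +
          (1 - (j.+1%:R - p * m.+1%:R)) * node m j.+1 = p.
  by rewrite /node -!natr1; field; rewrite ?(addrC 1) ?natr1 pnatr_eq0.
have := ju; have := jl; rewrite -!natr1 => jl' ju' H.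
have {H} := H ltac:(lra).
by apply: le_trans; apply: eqW; ring.
Qed.

(** Both nodes of the cell of [p] lie within [1 / m.+1] of [p]. *)
Lemma polygon_ge m h p : concave_bump h -> 0 < p < 1 ->
  h p * (1 - m.+1%:R^-1 / (p * (1 - p))) <= polygon m h p.
Proof.
move=> hb /[dup] p01 /andP[p0 p1].
have /(ex_node m)[j jm /[dup] pj /andP[]] : 0 <= p <= 1 by lra.
have [h0 h1 _] := hb.
have n0 : 0 < m.+1%:R :> R by rewrite ltr0n.
rewrite (polygonE h0 h1 jm pj) => jl ju.
have jE : node m j.+1 = node m j + m.+1%:R^-1 :> R.
  by rewrite /node -natr1 mulrDl mul1r.
have Hj : h p * (1 - m.+1%:R^-1 / (p * (1 - p))) <= h (node m j).
  apply: concave_bump_near_ge => //; first exact/node_itv/leqW.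
  by rewrite ger0_norm ?subr_ge0// lerBlDl -jE.
have Hj1 : h p * (1 - m.+1%:R^-1 / (p * (1 - p))) <= h (node m j.+1).
  apply: concave_bump_near_ge => //; first exact/node_itv.
  by rewrite ler0_norm ?subr_le0// opprB lerBlDl jE lerD2r.
move: jl ju; rewrite {1 2}/node ler_pdivrMr// ler_pdivlMr// => jl ju.
have a0 : 0 <= j.+1%:R - p * m.+1%:R by lra.
have b0 : 0 <= p * m.+1%:R - j%:R by lra.
have := lerD (ler_wpM2r a0 Hj) (ler_wpM2r b0 Hj1); apply: le_trans.
by rewrite -mulrDr -natr1; apply: eqW; ring.
Qed.

Lemma polygon_cvg h p : concave_bump h -> 0 <= p <= 1 ->
  polygon m h p @[m --> \oo] --> h p.
Proof.
move=> hb /[dup] p01 /andP[p0 p1].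
have [h0 h1 _] := hb.
have [->|pn0] := eqVneq p 0.
  rewrite h0 (_ : (fun _ => _) = cst 0); first exact: cvg_cst.
  apply/funext => m; rewrite (polygonE (j := 0%N) h0 h1)//; last first.
    by rewrite node0 lexx/=; have /andP[] := @node_itv m 1 isT.
  by rewrite node0 h0 !mul0r subrr mulr0 add0r.
have [->|pn1] := eqVneq p 1.
  rewrite h1 (_ : (fun _ => _) = cst 0); first exact: cvg_cst.
  apply/funext => m; rewrite (polygonE (j := m) h0 h1)//; last first.
    by rewrite node1 lexx andbT; have /andP[] := @node_itv m m (leqnSn m).
  by rewrite node1 h1 mul1r subrr mulr0 mul0r addr0.
have pp : 0 < p < 1 by rewrite !lt_neqAle eq_sym pn0 p0 pn1 p1.
apply: (@squeeze_cvgr _ _ _ _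
  (fun m => h p * (1 - m.+1%:R^-1 / (p * (1 - p)))) (cst (h p))).
- by apply: nearW => m; rewrite polygon_ge//= polygon_le.
- have : h p * (1 - m.+1%:R^-1 / (p * (1 - p))) @[m --> \oo] -->
      h p * (1 - 0 / (p * (1 - p))).
    apply: cvgMr; apply: cvgB; first exact: cvg_cst.
    by apply: cvgMl; exact: cvg_harmonic.
  by rewrite mul0r subr0 mulr1.
- exact: cvg_cst.
Qed.

Lemma polygon_ge0 m h (p : R) : concave_bump h -> 0 <= p <= 1 ->
  0 <= polygon m h p.
Proof.
move=> hb p01; rewrite /polygon big_mkord sumr_ge0// => k _.
by rewrite !mulr_ge0// ?bend_ge0// tent_ge0// node_itv// ltnS ltnW// ltnS.
Qed.

End polygons.

(** * Survival functions *)

Section survival_functions.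
Context {d : measure_display} {T : measurableType d} {R : realType}.
Variable P : probability T R.
Implicit Type Y : {RV P >-> R}.

Lemma survivalE Y t : (survival Y t)%:E = ccdf Y t.
Proof. by rewrite /survival fineK// fin_num_measure. Qed.

Lemma survival_cdf Y t : (1 - survival Y t)%:E = cdf Y t.
Proof. by rewrite EFinB survivalE cdf_1_ccdf. Qed.

Lemma survival_itv Y t : 0 <= survival Y t <= 1.
Proof. by rewrite -!lee_fin survivalE measure_ge0 probability_le1. Qed.

Lemma survival_le Y s t : s <= t -> survival Y t <= survival Y s.
Proof. by move=> st; rewrite -lee_fin !survivalE ccdf_nonincreasing. Qed.

Lemma measurable_survival Y : measurable_fun [set: R] (survival Y).
Proof. by apply: nonincreasing_measurable => // s t st; exact: survival_le. Qed.

Lemma survival_cvgy Y : survival Y t @[t --> +oo] --> (0 : R).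
Proof. by apply: fine_cvg; exact: cvg_ccdfy0. Qed.

Lemma survival_cvgNy Y : survival Y t @[t --> -oo] --> (1 : R).
Proof. by apply: fine_cvg; exact: cvg_ccdfNy1. Qed.

Lemma survival_deductible Y x t :
  survival (P := P) (deductible x \o Y) t =
  if 0 <= t then survival Y (t + x) else 1.
Proof.
rewrite /survival /ccdf /distribution /pushforward/=; case: ifPn => t0.
  congr (fine (P _)); apply/seteqP; split => w /=; rewrite !in_itv/= !andbT.
    by rewrite /deductible lt_max ltrBrDr [t < 0]ltNge t0 orbF.
  by rewrite /deductible lt_max ltrBrDr => ->.
rewrite [X in P X](_ : _ = setT) ?probability_setT//.
apply/seteqP; split => // w _ /=; rewrite in_itv/= andbT.
by rewrite /deductible lt_max [t < 0]ltNge t0 orbT.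
Qed.

Lemma survival_retained Y x t :
  survival (P := P) (Y \- (deductible x \o Y)) t =
  if t < x then survival Y t else 0.
Proof.
have E w : Y w - deductible x (Y w) = Num.min (Y w) x.
  rewrite /deductible; case: (leP (Y w) x) => Yx.
    by rewrite max_r ?subr_le0// subr0.
  by rewrite max_l ?subr_ge0 ?ltW// subKr.
rewrite /survival /ccdf /distribution /pushforward/=; case: ifPn => tx.
  congr (fine (P _)); apply/seteqP; split => w /=; rewrite !in_itv/= !andbT E.
    by rewrite lt_min => /andP[].
  by rewrite lt_min tx andbT.
rewrite [X in P X](_ : _ = set0) ?measure0//.
apply/seteqP; split => // w /=; rewrite in_itv/= andbT E lt_min.
by rewrite (negbTE tx) andbF.
Qed.

End survival_functions.

(** * Integrals over the line *)

Section lebesgue_line.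
Context {R : realType}.
Notation mu := (@lebesgue_measure R).

Lemma lebesgue_measure_shift (x : R) (A : set R) : measurable A ->
  pushforward mu (fun t : measurableTypeR R => t + x : measurableTypeR R) A
  = mu A.
Proof.
have mx : measurable_fun [set: measurableTypeR R]
    (fun t : measurableTypeR R => t + x : measurableTypeR R).
  exact: measurable_funD.
pose f : {mfun measurableTypeR R >-> measurableTypeR R} :=
  HB.pack (fun t : measurableTypeR R => t + x : measurableTypeR R)
    (isMeasurableFun.Build _ _ _ _ _ mx).
move=> mA; rewrite -[LHS]/(pushforward mu f A).
apply/esym/lebesgue_measure_unique => //= _ [[a b]] _ <-.
rewrite /pushforward/=.
rewrite (_ : _ @^-1` _ = `]a - x, b - x]%classic); last first.
  by apply/seteqP; split=> t /=; rewrite !in_itv/= ltrBlDr lerBrDr.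
rewrite !lebesgue_measure_itv/= !lte_fin ltrD2r; case: ifP => // _.
by rewrite -!EFinD; congr EFin; ring.
Qed.

Lemma ge0_integral_shift (x : R) (D : set R) (f : R -> \bar R) : measurable D ->
  measurable_fun [set: R] f -> (forall t, 0 <= f t)%E ->
  (\int[mu]_(t in D) f t =
   \int[mu]_(t in (fun t => t + x)%R @^-1` D) f (t + x)%R)%E.
Proof.
move=> mD mf f0.
have mx : measurable_fun [set: measurableTypeR R]
    (fun t : measurableTypeR R => t + x : measurableTypeR R).
  exact: measurable_funD.
rewrite -(ge0_integral_pushforward mx)//; last exact: measurable_funTS.
by apply: eq_measure_integral => //= A mA _; exact/esym/lebesgue_measure_shift.
Qed.

Lemma ge0_integral_split (x : R) (f : R -> \bar R) :
  measurable_fun [set: R] f -> (forall t, 0 <= f t)%E ->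
  (\int[mu]_t f t = \int[mu]_(t in `]-oo, x[) f t +
                    \int[mu]_(t in `[x, +oo[) f t)%E.
Proof.
move=> mf f0; rewrite -ge0_integral_setU//=.
- by rewrite itv_setU_setT.
- exact: measurable_funTS.
- exact: disjoint_rays.
Qed.

End lebesgue_line.

(** * Deviations of tents and the pinball loss *)

(** The loss whose expected value is least at a point exceeded with
    probability [s]: it charges [1 - s] for each unit above the target and [s]
    for each unit below. *)
Definition pinball {R : realType} (s u : R) : R :=
  Num.max ((1 - s) * u) (- (s * u)).

Section pinball.
Context {R : realType}.
Implicit Types s u v : R.

Lemma measurable_pinball (s x : R) :
  measurable_fun [set: R] (fun y => pinball s (y - x)).
Proof.
apply: measurable_maxr.
  by apply: measurable_funM => //; apply: measurable_funB.
by apply: measurableT_comp => //; apply: measurable_funM => //;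
  apply: measurable_funB.
Qed.

Lemma pinball_ge0 s u : 0 <= s <= 1 -> 0 <= pinball s u.
Proof.
move=> /andP[s0 s1]; rewrite /pinball le_max.
have [u0|u0] := leP 0 u; first by rewrite mulr_ge0// subr_ge0.
by rewrite oppr_ge0 mulr_ge0_le0 ?orbT// ltW.
Qed.

Lemma pinballD s u v : pinball s (u + v) <= pinball s u + pinball s v.
Proof.
rewrite /pinball ge_max !mulrDr opprD; apply/andP; split.
  by apply: lerD; rewrite le_max lexx.
by apply: lerD; rewrite le_max lexx orbT.
Qed.

End pinball.

Section deviation.
Context {d : measure_display} {T : measurableType d} {R : realType}.
Variable P : probability T R.
Implicit Types (Y : {RV P >-> R}) (h : R -> R).
Notation mu := (@lebesgue_measure R).

Definition deviation h Y : \bar R :=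
  (\int[mu]_t (h (survival Y t))%:E)%E.

Lemma expectation_deductible Y x :
  ('E_P[deductible x \o Y] =
   \int[mu]_(t in `[x, +oo[) (survival Y t)%:E)%E.
Proof.
rewrite ge0_expectation_ccdf => [|w]; last by rewrite /= le_max lexx orbT.
rewrite (@ge0_integral_shift _ x)//; last 2 first.
- by apply/measurable_EFinP; exact: measurable_survival.
- by move=> t; rewrite lee_fin; have /andP[] := survival_itv Y t.
rewrite [X in (\int[mu]_(t in X) (survival _ _)%:E)%E](_ : _ = `[0, +oo[%classic);
  last by apply/seteqP; split=> t /=; rewrite !in_itv/= !andbT lerDr.
apply: eq_integral => t; rewrite inE/= in_itv/= andbT => t0.
by rewrite -survivalE survival_deductible t0.
Qed.

(** [Y - deductible x Y], that is [min (Y, x)], is the form in which the loss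
    kept by the buyer appears in an allocation; the integrand is its shortfall
    below [x]. *)
Lemma expectation_retained Y x :
  (\int[P]_w (x - (Y w - deductible x (Y w)))%:E =
   \int[mu]_(t in `]-oo, x[) (1 - survival Y t)%:E)%E.
Proof.
have E w : Y w - deductible x (Y w) <= x.
  by rewrite lerBlDr -lerBlDl /deductible le_max lexx.
(* The tail formula of this nonpositive variable involves the probabilities
   of [Y <= t], the exact complements of the survival function; that of its
   opposite would involve those of [Y < t]. *)
pose W : {RV P >-> R} := (Y \- (deductible x \o Y)) \- cst x.
have : ('E_P[W] = - \int[mu]_(r in `]-oo, 0%R[) cdf W r)%E.
  by apply: le0_expectation_cdf => w; rewrite /W/= subr_le0.
rewrite expectation_def => EW.
have -> : (\int[P]_w (x - (Y w - deductible x (Y w)))%:E =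
    - \int[P]_w (W w)%:E)%E.
  rewrite [in RHS](eq_integral (fun w => - (x - (Y w - deductible x (Y w)))%:E)%E).
    by rewrite integral_ge0N ?oppeK// => w _; rewrite lee_fin subr_ge0.
  by move=> w _; rewrite -EFinN /W/= opprB.
rewrite EW oppeK [RHS](@ge0_integral_shift _ x)//; last 2 first.
- by apply/measurable_EFinP; apply: measurable_funB => //;
    exact: measurable_survival.
- by move=> t; rewrite lee_fin subr_ge0; have /andP[] := survival_itv Y t.
rewrite [X in (\int[mu]_(t in X) (1 - survival _ _)%:E)%E](_ : _ =
    `]-oo, 0[%classic);
  last by apply/seteqP; split=> t /=; rewrite !in_itv/= gtrDr.
apply: eq_integral => t; rewrite inE/= in_itv/= => t0.
have <- : survival (P := P) (Y \- (deductible x \o Y)) (t + x) =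
    survival Y (t + x) by rewrite survival_retained gtrDr t0.
rewrite survival_cdf /cdf /distribution /pushforward/=.
congr (P _); apply/seteqP; split=> w /=.
  by rewrite !in_itv/= lerBlDr.
by rewrite !in_itv/= -lerBlDr.
Qed.

Lemma measurable_tent_survival s Y :
  measurable_fun [set: R] (fun t => tent s (survival Y t)).
Proof.
have mS := measurable_survival Y.
apply: measurable_minr.
  by apply: measurable_funM.
by apply: measurable_funM => //; apply: measurable_funB.
Qed.

Lemma expectation_pinball s Y x : 0 <= s <= 1 ->
  (\int[P]_w (pinball s (Y w - x))%:E =
   \int[mu]_(t in `]-oo, x[) (s * (1 - survival Y t))%:E +
   \int[mu]_(t in `[x, +oo[) ((1 - s) * survival Y t)%:E)%E.
Proof.
move=> /andP[s0 s1].
have s1' : 0 <= 1 - s by rewrite subr_ge0.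
have retx w : Y w - deductible x (Y w) <= x.
  by rewrite lerBlDr -lerBlDl /deductible le_max lexx.
have ded0 w : 0 <= deductible x (Y w) by rewrite le_max lexx orbT.
have pE w : pinball s (Y w - x) =
    s * (x - (Y w - deductible x (Y w))) + (1 - s) * deductible x (Y w).
  rewrite /pinball /deductible.
  have [Yx|Yx] := leP (Y w) x.
    rewrite [Num.max (Y w - x) 0]max_r ?subr_le0// max_r; first ring.
    by nra.
  rewrite [Num.max (Y w - x) 0]max_l ?subr_ge0 ?ltW// max_l; first ring.
  by nra.
under eq_integral do rewrite pE EFinD !EFinM.
have mdY : measurable_fun [set: T] (fun w => deductible x (Y w)).
  exact: (measurableT_comp (measurable_deductible x)).
rewrite ge0_integralD//; last 4 first.
- by move=> w _; rewrite -EFinM lee_fin mulr_ge0// subr_ge0.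
- by apply/measurable_EFinP; apply: measurable_funM => //;
    apply: measurable_funB => //; apply: measurable_funB.
- by move=> w _; rewrite -EFinM lee_fin mulr_ge0.
- by apply/measurable_EFinP; apply: measurable_funM.
rewrite ge0_integralZl_EFin//; last 2 first.
- by move=> w _; rewrite lee_fin subr_ge0.
- by apply/measurable_EFinP; apply: measurable_funB => //; apply: measurable_funB.
rewrite ge0_integralZl_EFin//; last 2 first.
- by move=> w _; rewrite lee_fin.
- exact/measurable_EFinP.
have := expectation_deductible Y x; rewrite expectation_def/= => ->.
rewrite expectation_retained -!ge0_integralZl_EFin//.
- by move=> t _; rewrite lee_fin; have /andP[] := survival_itv Y t.
- by apply/measurable_EFinP/measurable_funTS; exact: measurable_survival.
- by move=> t _; rewrite lee_fin subr_ge0; have /andP[] := survival_itv Y t.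
- apply/measurable_EFinP; apply: measurable_funB => //.
  by apply: measurable_funTS; exact: measurable_survival.
Qed.

(** As functions of the survival probability [p] of a layer, the expected
    pinball loss integrates [s (1 - p)] below [x] and [(1 - s) p] above, and
    the tent is the smaller of the two. *)
Lemma tent_deviation_le s Y x : 0 <= s <= 1 ->
  (deviation (tent s) Y <= \int[P]_w (pinball s (Y w - x))%:E)%E.
Proof.
move=> s01; have /andP[s0 s1] := s01.
rewrite expectation_pinball// /deviation (@ge0_integral_split _ x); last 2 first.
- by apply/measurable_EFinP; exact: measurable_tent_survival.
- by move=> t; rewrite lee_fin tent_ge0// survival_itv.
have mS := measurable_survival Y.
apply: leeD; apply: ge0_le_integral => //.
- by move=> t _; rewrite lee_fin tent_ge0// survival_itv.
- by apply/measurable_EFinP/measurable_funTS; exact: measurable_tent_survival.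
- apply/measurable_EFinP/measurable_funTS; apply: measurable_funM => //.
  exact: measurable_funB.
- by move=> t _; rewrite lee_fin ge_min lexx orbT.
- by move=> t _; rewrite lee_fin tent_ge0// survival_itv.
- by apply/measurable_EFinP/measurable_funTS; exact: measurable_tent_survival.
- by apply/measurable_EFinP/measurable_funTS; apply: measurable_funM.
- by move=> t _; rewrite lee_fin ge_min mulrC lexx.
Qed.

Lemma ex_quantile s Y : 0 < s < 1 -> exists x,
  (forall t, t < x -> s <= survival Y t) /\
  (forall t, x < t -> survival Y t <= s).
Proof.
move=> /andP[s0 s1]; pose A := [set t | survival Y t <= s].
have A0 : A !=set0.
  have [t St] := filter_ex (cvgr_lt _ (survival_cvgy Y) s s0).
  by exists t; exact: ltW.
have lA : has_lbound A.
  have [M [_ HM]] := cvgr_gt _ (survival_cvgNy Y) s s1.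
  exists M => u Au; rewrite leNgt; apply/negP => /HM.
  by rewrite ltNge Au.
exists (inf A); split=> t.
  move=> tx; rewrite leNgt; apply/negP => /ltW St.
  by move: tx; rewrite ltNge => /negP; apply; exact: ge_inf.
by move=> /(inf_lt A0)[u Au /ltW /survival_le/le_trans]; apply.
Qed.

(** At a quantile the expected pinball loss switches from one line to the
    other exactly where they cross, so that it integrates their minimum. *)
Lemma tent_deviation_quantile s Y : 0 < s < 1 -> exists x,
  (\int[P]_w (pinball s (Y w - x))%:E <= deviation (tent s) Y)%E.
Proof.
move=> s01; have /andP[s0 s1] := s01.
have s01' : 0 <= s <= 1 by rewrite !ltW.
have [x [xl xr]] := ex_quantile Y s01; exists x.
have mS := measurable_survival Y.
rewrite expectation_pinball// /deviation (@ge0_integral_split _ x); last 2 first.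
- by apply/measurable_EFinP; exact: measurable_tent_survival.
- by move=> t; rewrite lee_fin tent_ge0// survival_itv.
apply: leeD.
  apply: eqW; apply: eq_integral => t.
  rewrite inE/= in_itv/= => /xl St; rewrite /tent min_r//.
  by rewrite !mulrBr !mulr1 lerB// mulrC.
(* [ex_quantile] leaves out the layer [x] itself, a null set. *)
rewrite -integral_itv_obnd_cbnd; last first.
  by apply/measurable_EFinP/measurable_funTS; exact: measurable_tent_survival.
rewrite -integral_itv_obnd_cbnd; last first.
  by apply/measurable_EFinP/measurable_funTS; apply: measurable_funM.
apply: eqW; apply: eq_integral => t.
rewrite inE/= in_itv/= andbT => /xr St; rewrite /tent min_l; first by rewrite mulrC.
by rewrite !mulrBr !mulr1 lerB// mulrC.
Qed.

End deviation.

(** * Subadditivity of deviations *)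

Section subadditivity.
Context {d : measure_display} {T : measurableType d} {R : realType}.
Variable P : probability T R.
Implicit Types (X Y : {RV P >-> R}) (h : R -> R).
Notation mu := (@lebesgue_measure R).

(** The sum of two quantiles is a candidate target for the sum of the losses,
    and the pinball loss is subadditive. *)
Lemma tent_deviation_subadditive (s : R) X Y1 Y2 : 0 < s < 1 ->
  {ae P, forall w, Y1 w + Y2 w = X w} ->
  (deviation (tent s) X <= deviation (tent s) Y1 + deviation (tent s) Y2)%E.
Proof.
move=> s01 YX; have s01' : 0 <= s <= 1 by case/andP: s01 => ? ?; rewrite !ltW.
have [x1 Y1x1] := tent_deviation_quantile Y1 s01.
have [x2 Y2x2] := tent_deviation_quantile Y2 s01.
have mp (Y : {RV P >-> R}) x :
    measurable_fun [set: T] (fun w => (pinball s (Y w - x))%:E).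
  by apply/measurable_EFinP; exact: (measurableT_comp (measurable_pinball s x)).
apply: le_trans (leeD Y1x1 Y2x2).
apply: le_trans (tent_deviation_le X (x1 + x2) s01') _.
rewrite -ge0_integralD//; last 2 first.
- by move=> w _; rewrite lee_fin pinball_ge0.
- by move=> w _; rewrite lee_fin pinball_ge0.
apply: ae_ge0_le_integral => //.
- by move=> w _; rewrite lee_fin pinball_ge0.
- by move=> w _; rewrite -EFinD lee_fin addr_ge0// pinball_ge0.
- exact: emeasurable_funD.
apply: filterS YX => w <- _; rewrite -EFinD lee_fin.
by rewrite opprD addrACA pinballD.
Qed.

Lemma measurable_polygon_survival m h Y :
  measurable_fun [set: R] (fun t => polygon m h (survival Y t)).
Proof.
apply: measurable_sum => k; apply: measurable_funM => //.
exact: measurable_tent_survival.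
Qed.

(** Pointwise limit of the same statement for polygons. *)
Lemma measurable_bump_survival h Y : concave_bump h ->
  measurable_fun [set: R] (fun t => h (survival Y t)).
Proof.
move=> hb; apply: (measurable_fun_cvg
  (h := fun m t => polygon m h (survival Y t))) => [m|t _].
  exact: measurable_polygon_survival.
exact: polygon_cvg (survival_itv Y t).
Qed.

Lemma bump_survival_ge0 h Y t : concave_bump h -> 0 <= h (survival Y t).
Proof. by move=> hb; apply: (concave_bump_ge0 hb); exact: survival_itv. Qed.

Lemma polygon_deviation m h Y : concave_bump h ->
  deviation (polygon m h) Y =
  (\sum_(k < m) (m.+1%:R * bend m h k)%:E *
    deviation (tent (node m k.+1)) Y)%E.
Proof.
move=> hb; rewrite /deviation.
under eq_integral do rewrite /polygon big_mkord -sumEFin.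
have c0 (k : 'I_m) : 0 <= m.+1%:R * bend m h k by rewrite mulr_ge0// bend_ge0.
have t0 (k : 'I_m) (t : R) : 0 <= tent (node m k.+1) (survival Y t).
  by rewrite tent_ge0 ?survival_itv ?node_itv// ltnS ltnW// ltnS.
have mt (k : 'I_m) :
    measurable_fun [set: R] (fun t => (tent (node m k.+1) (survival Y t))%:E).
  by apply/measurable_EFinP; exact: measurable_tent_survival.
rewrite ge0_integral_sum//; last 2 first.
- move=> k; apply/measurable_EFinP; apply: measurable_funM => //.
  exact: measurable_tent_survival.
- by move=> k t _; rewrite lee_fin mulr_ge0.
apply: eq_bigr => k _; under eq_integral do rewrite EFinM.
rewrite ge0_integralZl_EFin//; last first.
  exact: mt.
by move=> t _; rewrite lee_fin.
Qed.

Lemma deviation_ge0 h Y : concave_bump h -> (0 <= deviation h Y)%E.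
Proof.
move=> hb; apply: integral_ge0 => t _.
by rewrite lee_fin concave_bump_ge0// survival_itv.
Qed.

Lemma polygon_deviation_subadditive m h X Y1 Y2 : concave_bump h ->
  {ae P, forall w, Y1 w + Y2 w = X w} ->
  (deviation (polygon m h) X <=
   deviation (polygon m h) Y1 + deviation (polygon m h) Y2)%E.
Proof.
move=> hb YX; rewrite !polygon_deviation// -big_split/=.
apply: lee_sum => k _.
have c0 : 0 <= m.+1%:R * bend m h k by rewrite mulr_ge0// bend_ge0.
have k01 : 0 < (node m k.+1 : R) < 1.
  by rewrite /node divr_gt0//= ltr_pdivrMr// mul1r ltr_nat ltnS.
have t0 Y : (0 <= deviation (tent (node m k.+1)) Y)%E.
  apply: integral_ge0 => t _; rewrite lee_fin tent_ge0// ?survival_itv//.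
  by case/andP: k01 => ? ?; rewrite !ltW.
rewrite -ge0_muleDr//; apply: lee_wpmul2l; first by rewrite lee_fin.
exact: tent_deviation_subadditive.
Qed.

Lemma polygon_deviation_le m h Y : concave_bump h ->
  (deviation (polygon m h) Y <= deviation h Y)%E.
Proof.
move=> hb; apply: ge0_le_integral => //.
- by move=> t _; rewrite lee_fin polygon_ge0// survival_itv.
- by apply/measurable_EFinP; exact: measurable_polygon_survival.
- by apply/measurable_EFinP; exact: measurable_bump_survival.
- by move=> t _; rewrite lee_fin polygon_le// survival_itv.
Qed.

(** Fatou bounds the left-hand side by the lower limit of the deviations of
    the polygons; on the right-hand side polygons lie below [h]. *)
Theorem deviation_subadditive h X Y1 Y2 : concave_bump h ->
  {ae P, forall w, Y1 w + Y2 w = X w} ->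
  (deviation h X <= deviation h Y1 + deviation h Y2)%E.
Proof.
move=> hb YX.
have -> : deviation h X =
    (\int[mu]_t limn_einf (fun m => (polygon m h (survival X t))%:E))%E.
  apply: eq_integral => t _.
  have : ((polygon m h (survival X t))%:E @[m --> \oo] --> (h (survival X t))%:E)%E.
    by apply: cvg_EFin; [exact: nearW | exact: polygon_cvg (survival_itv X t)].
  by move=> /cvg_limn_einf_sup[].
apply: le_trans.
  apply: fatou => // [m|m t _].
    by apply/measurable_EFinP; exact: measurable_polygon_survival.
  by rewrite lee_fin polygon_ge0// survival_itv.
rewrite limn_einf_lim; apply: lime_le; first exact: is_cvg_einfs.
apply: nearW => m; apply: le_trans (leeD (polygon_deviation_le m Y1 hb)
  (polygon_deviation_le m Y2 hb)).
apply: le_trans (polygon_deviation_subadditive m hb YX).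
by apply: ereal_inf_lbound; exists m => //=.
Qed.

End subadditivity.

(** * Risk measures, preferences and Pareto optimality *)

Section preferences.
Context {d : measure_display} {T : measurableType d} {R : realType}.
Variable P : probability T R.
Implicit Types (X Y Z : {RV P >-> R}) (g h : R -> R).
Notation mu := (@lebesgue_measure R).

Lemma expectation_Lfun Y : ('E_P[Y])%E \is a fin_num ->
  (Y : T -> R) \in Lfun P 1.
Proof.
rewrite expectation_def -integral_fin_num_abs// => Yfin.
apply/Lfun1_integrable/integrableP; split => //.
exact/measurable_EFinP.
Qed.

Lemma expectation_ae_add X Y1 Y2 : ('E_P[Y1])%E \is a fin_num ->
  ('E_P[Y2])%E \is a fin_num -> {ae P, forall w, Y1 w + Y2 w = X w} ->
  ('E_P[X])%E = ('E_P[Y1] + 'E_P[Y2])%E.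
Proof.
move=> /expectation_Lfun Y1L /expectation_Lfun Y2L YX.
rewrite -expectationD// !expectation_def; apply: ae_eq_integral => //.
- exact/measurable_EFinP.
- by apply/measurable_EFinP; exact: measurable_funD.
- by apply: filterS YX => w /= <- _.
Qed.

(** Subtracting the tail formula for the mean from the definition of the risk.
    The finiteness of the mean makes the negative part finite, so that only
    the upper tail of the deviation may be infinite and the algebra is
    legitimate. *)
Lemma distortion_riskE g Y : concave_distortion g ->
  ('E_P[Y])%E \is a fin_num ->
  distortion_risk g Y = ('E_P[Y] + deviation (excess g) Y)%E.
Proof.
move=> gd EY; have hb := distortion_bump gd.
have [g01 _ _ _ _] := gd.
have mS := measurable_survival Y.
have mh : measurable_fun [set: R] (fun t => g (survival Y t) - survival Y t).
  exact: measurable_bump_survival hb.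
have mg : measurable_fun [set: R] (fun t => g (survival Y t)).
  apply: (eq_measurable_fun (fun t => g (survival Y t) - survival Y t + survival Y t)).
    by move=> t _; rewrite subrK.
  exact: measurable_funD.
have h0 t : 0 <= g (survival Y t) - survival Y t.
  by rewrite (concave_bump_ge0 hb)// survival_itv.
have S0 t : 0 <= survival Y t by have /andP[] := survival_itv Y t.
have g1 t : 0 <= 1 - g (survival Y t).
  have /g01 : survival Y t \in `[0, 1] by rewrite in_itv/= survival_itv.
  by rewrite in_itv/= subr_ge0 => /andP[].
have := expectation_cdf_ccdf (expectation_Lfun EY).
rewrite (_ : (\int[mu]_(r in `[0%R, +oo[) ccdf Y r)%E =
    (\int[mu]_(t in `[0%R, +oo[) (survival Y t)%:E)%E); last first.
  by apply: eq_integral => t _; rewrite survivalE.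
rewrite (_ : (\int[mu]_(r in `]-oo, 0%R[) cdf Y r)%E =
    (\int[mu]_(t in `]-oo, 0%R[) (1 - g (survival Y t))%:E +
     \int[mu]_(t in `]-oo, 0%R[) (g (survival Y t) - survival Y t)%:E)%E); last first.
  rewrite -ge0_integralD//.
  - by apply: eq_integral => t _; rewrite -survival_cdf -EFinD addrA subrK.
  - by move=> t _; rewrite lee_fin.
  - by apply/measurable_EFinP/measurable_funTS; exact: measurable_funB.
  - by move=> t _; rewrite lee_fin.
  - exact/measurable_EFinP/measurable_funTS.
rewrite /deviation /excess (@ge0_integral_split _ 0); last 2 first.
- exact/measurable_EFinP.
- by move=> t; rewrite lee_fin.
rewrite /distortion_risk.
rewrite (_ : (\int[mu]_(t in `]-oo, 0%R[) (g (survival Y t) - 1)%:E)%E =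
    (- \int[mu]_(t in `]-oo, 0%R[) (1 - g (survival Y t))%:E)%E); last first.
  rewrite -integral_ge0N/=; last by move=> t _; rewrite lee_fin.
  by apply: eq_integral => t _; rewrite opprB.
rewrite (_ : (\int[mu]_(t in `[0%R, +oo[) (g (survival Y t))%:E)%E =
    (\int[mu]_(t in `[0%R, +oo[) (survival Y t)%:E +
     \int[mu]_(t in `[0%R, +oo[) (g (survival Y t) - survival Y t)%:E)%E); last first.
  rewrite -ge0_integralD//.
  - by apply: eq_integral => t _; rewrite -EFinD addrC subrK.
  - by move=> t _; rewrite lee_fin.
  - exact/measurable_EFinP/measurable_funTS.
  - by move=> t _; rewrite lee_fin.
  - exact/measurable_EFinP/measurable_funTS.
set A := (\int[mu]_(t in `[0%R, +oo[) (survival Y t)%:E)%E.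
set N := (\int[mu]_(t in _) (1 - g _)%:E)%E.
set M1 := (\int[mu]_(t in `]-oo, 0%R[) (g _ - _)%:E)%E.
set M2 := (\int[mu]_(t in `[0%R, +oo[) (g _ - _)%:E)%E.
have M20 : (0 <= M2)%E by apply: integral_ge0 => t _; rewrite lee_fin.
move=> EYE; move: EY; rewrite {}EYE fin_numB => /andP[Af].
rewrite fin_numD => /andP[Nf Mf].
rewrite -(fineK Af) -(fineK Nf) -(fineK Mf).
case: M2 M20 => // M2 _.

by rewrite -!EFinN -!EFinD; congr EFin; ring.
Qed.

Lemma distortion_risk_fin g Y : concave_distortion g ->
  ('E_P[Y])%E \is a fin_num ->
  (distortion_risk g Y \is a fin_num) =
  (deviation (excess g) Y \is a fin_num).
Proof. by move=> gd EY; rewrite distortion_riskE// fin_numD EY. Qed.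

Lemma expectation_ae_deductible0 X : {ae P, forall w, 0 <= X w} ->
  ('E_P[X] = 'E_P[deductible 0 \o X])%E.
Proof.
move=> X0; rewrite !expectation_def; apply: ae_eq_integral => //.
- exact/measurable_EFinP.
- by apply/measurable_EFinP; exact: (measurableT_comp (measurable_deductible 0)).
- by apply: filterS X0 => w Xw _ /=; rewrite /deductible subr0 max_l.
Qed.

(** The mean of a nonnegative loss is dominated by its distortion risk. *)
Lemma expectation_fin_of_risk g X : {ae P, forall w, 0 <= X w} ->
  concave_distortion g -> distortion_risk g X \is a fin_num ->
  ('E_P[X])%E \is a fin_num.
Proof.
move=> X0 gd; rewrite /distortion_risk fin_numD => /andP[_ I2].
have [g01 _ _ _ _] := gd; have hb := distortion_bump gd.
have mS := measurable_survival X.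
have mh := measurable_bump_survival X hb.
rewrite (expectation_ae_deductible0 X0).
have S0 t : 0 <= survival X t by have /andP[] := survival_itv X t.
rewrite expectation_deductible ge0_fin_numE; last first.
  by apply: integral_ge0 => t _; rewrite lee_fin.
apply: le_lt_trans (_ : \int[mu]_(t in `[0%R, +oo[) (g (survival X t))%:E < +oo)%E.
  apply: ge0_le_integral => //.
  - by move=> t _; rewrite lee_fin.
  - exact/measurable_EFinP/measurable_funTS.
  - apply/measurable_EFinP/measurable_funTS.
    apply: (eq_measurable_fun (fun t => g (survival X t) - survival X t + survival X t)).
      by move=> t _; rewrite subrK.
    exact: measurable_funD.
  - by move=> t _; rewrite lee_fin -subr_ge0 (concave_bump_ge0 hb)// survival_itv.
rewrite -ge0_fin_numE//; apply: integral_ge0 => t _; rewrite lee_fin.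
have /g01 : survival X t \in `[0, 1] by rewrite in_itv/= survival_itv.
by rewrite in_itv/= => /andP[].
Qed.

Lemma V1E g (b theta : R) Y (e D : R) : concave_distortion g ->
  ('E_P[Y])%E = e%:E -> deviation (excess g) Y = D%:E ->
  V1 g b theta Y = ((1 + b) * D + (b - theta) * e)%:E.
Proof.
move=> gd EY dY; rewrite /V1 distortion_riskE ?EY// dY.
by rewrite -(EFinD e D) -!EFinM -EFinB; congr EFin; ring.
Qed.

(** Infinite terms never cancel, as [+oo - +oo] is [-oo]. *)
Lemma V1_fin g (b theta : R) Y : concave_distortion g -> 0 < 1 + b ->
  0 < 1 + theta -> V1 g b theta Y \is a fin_num ->
  exists e D, ('E_P[Y])%E = e%:E /\ deviation (excess g) Y = D%:E.
Proof.
move=> gd b0 th0; rewrite /V1 fin_numB => /andP[Hfin Efin].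
have EY : ('E_P[Y])%E \is a fin_num.
  move: Efin; case: ('E_P[Y])%E => //.
    by rewrite gt0_muley ?lte_fin.
  by rewrite gt0_muleNy ?lte_fin.
have dY : deviation (excess g) Y \is a fin_num.
  rewrite -distortion_risk_fin//; move: Hfin; case: (distortion_risk g Y) => //.
    by rewrite gt0_muley ?lte_fin.
  by rewrite gt0_muleNy ?lte_fin.
by exists (fine ('E_P[Y])%E), (fine (deviation (excess g) Y)); rewrite !fineK.
Qed.

(** The buyer is an insurer with [b1 = 0], so facts on [V1] serve for both. *)
Lemma V2_V1 g (theta : R) Y : V2 g theta Y = V1 g 0 theta Y.
Proof. by rewrite /V2 /V1 addr0 mul1e. Qed.

(** The right-hand side is a lower bound of the left-hand side over all
    allocations, so the hypothesis says that [(Y1, Y2)] minimises the weighted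
    sum [theta V1 + (theta - b1) V2], in which the means only enter through [E
    X]. *)
Lemma pareto_optimal_deviation g1 g2 (b1 theta : R) X Y1 Y2 :
  concave_distortion g1 -> concave_distortion g2 -> 0 < b1 -> b1 < theta ->
  {ae P, forall w, Y1 w + Y2 w = X w} ->
  ('E_P[Y1])%E \is a fin_num -> ('E_P[Y2])%E \is a fin_num ->
  deviation (excess g1) Y1 \is a fin_num ->
  deviation (excess g2) Y2 \is a fin_num ->
  ((theta * (1 + b1))%:E * deviation (excess g1) Y1 +
   (theta - b1)%:E * deviation (excess g2) Y2 <=
   deviation (fun p => Num.min (theta * (1 + b1) * excess g1 p)
                               ((theta - b1) * excess g2 p))%R X)%E ->
  pareto_optimal (V1 g1 b1 theta) (V2 g2 theta) X Y1 Y2.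
Proof.
move=> gd1 gd2 b0 bth YX EY1 EY2 dY1 dY2 YXle.
have th0 : 0 < theta by exact: lt_trans bth.
have a0 : 0 <= theta * (1 + b1) by rewrite mulr_ge0 ?addr_ge0// ltW.
have c0 : 0 <= theta - b1 by rewrite subr_ge0 ltW.
have hb1 := distortion_bump gd1; have hb2 := distortion_bump gd2.
have hbm := concave_bump_min (concave_bumpZ a0 hb1) (concave_bumpZ c0 hb2).
have ZXge Z1 Z2 : {ae P, forall w, Z1 w + Z2 w = X w} ->
    (deviation (fun p => Num.min (theta * (1 + b1) * excess g1 p)
                               ((theta - b1) * excess g2 p))%R X <=
     (theta * (1 + b1))%:E * deviation (excess g1) Z1 +
     (theta - b1)%:E * deviation (excess g2) Z2)%E.
  move=> ZX; apply: le_trans (deviation_subadditive hbm ZX) _.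
  apply: leeD; rewrite /deviation -ge0_integralZl_EFin//.
  - apply: ge0_le_integral => //.
    + by move=> t _; rewrite lee_fin (bump_survival_ge0 _ t hbm).
    + apply/measurable_EFinP; exact: measurable_bump_survival hbm.
    + apply/measurable_EFinP; apply: measurable_funM => //.
      exact: measurable_bump_survival.
    + by move=> t _; rewrite lee_fin ge_min lexx.
  - by move=> t _; rewrite lee_fin (bump_survival_ge0 _ t hb1).
  - by apply/measurable_EFinP; exact: measurable_bump_survival.
  - apply: ge0_le_integral => //.
    + by move=> t _; rewrite lee_fin (bump_survival_ge0 _ t hbm).
    + apply/measurable_EFinP; exact: measurable_bump_survival hbm.
    + apply/measurable_EFinP; apply: measurable_funM => //.
      exact: measurable_bump_survival.
    + by move=> t _; rewrite lee_fin ge_min lexx orbT.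
  - by move=> t _; rewrite lee_fin (bump_survival_ge0 _ t hb2).
  - by apply/measurable_EFinP; exact: measurable_bump_survival.
have EX := expectation_ae_add EY1 EY2 YX.
move: EX; rewrite -(fineK EY1) -(fineK EY2) -EFinD.
move: (esym (fineK EY1)) (esym (fineK EY2))
  (esym (fineK dY1)) (esym (fineK dY2)).
move: (fine _) (fine _) (fine _) (fine _) => D2 D1 e2 e1 E1 E2 dE1 dE2 EX.
have V1Y := V1E b1 theta gd1 E1 dE1.
have V2Y := V1E 0 theta gd2 E2 dE2.
split; first by split; rewrite ?V2_V1 ?V1Y ?V2Y.
move=> Z1 Z2 [ZX]; rewrite V2_V1 V2_V1.
have b10 : 0 < 1 + b1 by rewrite addr_gt0.
have b00 : 0 < 1 + 0 :> R by rewrite addr0.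
have th10 : 0 < 1 + theta by rewrite addr_gt0.
move=> /(V1_fin gd1 b10 th10) [f1 [G1 [F1 dF1]]].
move=> /(V1_fin gd2 b00 th10) [f2 [G2 [F2 dF2]]].
have := expectation_ae_add (Y1 := Z1) (Y2 := Z2) _ _ ZX.
rewrite F1 F2 => /(_ isT isT).
rewrite EX -EFinD => -[eE].
rewrite (V1E b1 theta gd1 F1 dF1) (V1E 0 theta gd2 F2 dF2) V1Y V2Y !lee_fin.
have := le_trans YXle (ZXge Z1 Z2 ZX).
rewrite dE1 dE2 dF1 dF2 -!EFinM -!EFinD lee_fin => DG v1 v2.
have c1 : 0 < theta - b1 by rewrite subr_gt0.
(* The weighted sum of the two improvements is nonpositive, while each of them
   is nonnegative. *)
have w1 := ler_wpM2l (ltW th0) v1; have w2 := ler_wpM2l c0 v2.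
have S1 : theta * ((1 + b1) * G1 + (b1 - theta) * f1) =
  theta * ((1 + b1) * D1 + (b1 - theta) * e1).
  by apply/eqP; rewrite eq_le w1/=; nra.
have S2 : (theta - b1) * ((1 + 0) * G2 + (0 - theta) * f2) =
  (theta - b1) * ((1 + 0) * D2 + (0 - theta) * e2).
  by apply/eqP; rewrite eq_le w2/=; nra.
split; congr EFin.
  by apply: (mulfI (lt0r_neq0 th0)).
by apply: (mulfI (lt0r_neq0 c1)).
Qed.

End preferences.

(** * Layers of a deductible contract *)

Section layers.
Context {d : measure_display} {T : measurableType d} {R : realType}.
Variable P : probability T R.
Implicit Types (X Y : {RV P >-> R}) (g h : R -> R).
Notation mu := (@lebesgue_measure R).

(** The insurer holds exactly the layers of [Y] above the deductible. *)
Lemma deviation_deductible h Y x : concave_bump h ->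
  deviation (P := P) h (deductible x \o Y) =
  (\int[mu]_(t in `[x, +oo[) (h (survival Y t))%:E)%E.
Proof.
move=> hb; have [h0 h1 _] := hb.
have hS0 (Z : {RV P >-> R}) t : (0 <= (h (survival Z t))%:E)%E.
  by rewrite lee_fin bump_survival_ge0.
have mh (Z : {RV P >-> R}) :
    measurable_fun [set: R] (fun t => (h (survival Z t))%:E).
  by apply/measurable_EFinP; exact: measurable_bump_survival.
rewrite /deviation (@ge0_integral_split _ 0)//.
rewrite integral0_eq => [|t]; last first.
  by rewrite /= in_itv/= survival_deductible ltNge => /negbTE->; rewrite h1.
rewrite add0e [RHS](@ge0_integral_shift _ x)//.
rewrite [X in _ = (\int[mu]_(t in X) _)%E](_ : _ = `[0, +oo[%classic);
  last by apply/seteqP; split=> t /=; rewrite !in_itv/= !andbT lerDr.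
apply: eq_integral => t; rewrite inE/= in_itv/= andbT => t0.
by rewrite survival_deductible t0.
Qed.

(** The buyer keeps exactly the layers of [Y] below the deductible. *)
Lemma deviation_retained h Y x : concave_bump h ->
  deviation (P := P) h (Y \- (deductible x \o Y)) =
  (\int[mu]_(t in `]-oo, x[) (h (survival Y t))%:E)%E.
Proof.
move=> hb; have [h0 h1 _] := hb.
have hS0 (Z : {RV P >-> R}) t : (0 <= (h (survival Z t))%:E)%E.
  by rewrite lee_fin bump_survival_ge0.
have mh (Z : {RV P >-> R}) :
    measurable_fun [set: R] (fun t => (h (survival Z t))%:E).
  by apply/measurable_EFinP; exact: measurable_bump_survival.
rewrite /deviation (@ge0_integral_split _ x)//.
rewrite [X in (_ + X)%E]integral0_eq => [|t]; last first.
  by rewrite /= in_itv/= andbT survival_retained leNgt => /negbTE->; rewrite h0.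
rewrite adde0; apply: eq_integral => t; rewrite inE/= in_itv/= => tx.
by rewrite survival_retained tx.
Qed.

Lemma survival_neg X t : {ae P, forall w, 0 <= X w} -> t < 0 ->
  survival X t = 1.
Proof.
move=> [N [mN PN0 XN]] t0; apply/eqP; rewrite eq_le.
have /andP[_ ->] := survival_itv X t; rewrite /= -lee_fin survivalE.
have <- : P (~` N) = 1%E by rewrite probability_setC// PN0 sube0.
apply: le_measure; rewrite ?inE//; first exact: measurableC.
  exact: measurable_funPTI.
move=> w Nw /=; rewrite in_itv/= andbT; apply: lt_le_trans t0 _.
by apply: contrapT => Xw; apply: Nw; apply: XN.
Qed.

Lemma survival_cst0 X t :
  survival (P := P) (cst 0 \o X) t = if 0 <= t then 0 else 1.
Proof.
rewrite /survival /ccdf /distribution /pushforward/=; case: ifPn => t0.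
  rewrite [X in P X](_ : _ = set0) ?measure0//.
  by apply/seteqP; split => // w /=; rewrite in_itv/= andbT ltNge t0.
rewrite [X in P X](_ : _ = setT) ?probability_setT//.
by apply/seteqP; split => // w _ /=; rewrite in_itv/= andbT ltNge.
Qed.

Lemma survival_subr0 X t :
  survival (P := P) (X \- (cst 0 \o X)) t = survival X t.
Proof.
rewrite /survival /ccdf /distribution /pushforward/=.
by congr (fine (P _)); apply/seteqP; split=> w /=; rewrite subr0.
Qed.

(** The lower bound is attained when the buyer is the cheaper holder below the
    deductible and the insurer above it; the layer at the deductible has
    measure zero. *)
Lemma pareto_deductible g1 g2 (b1 theta x : R) X :
  {ae P, forall w, 0 <= X w} ->
  concave_distortion g1 -> concave_distortion g2 ->
  {in `[0, 1], forall p, g1 p <= g2 p} ->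
  distortion_risk g2 X \is a fin_num -> 0 < b1 -> b1 < theta -> 0 <= x ->
  (forall t, t < x -> (theta - b1) * excess g2 (survival X t) <=
                      theta * (1 + b1) * excess g1 (survival X t)) ->
  (forall t, x < t -> theta * (1 + b1) * excess g1 (survival X t) <=
                      (theta - b1) * excess g2 (survival X t)) ->
  pareto_optimal (V1 g1 b1 theta) (V2 g2 theta) X
    (deductible x \o X) (X \- (deductible x \o X)).
Proof.
move=> X0 gd1 gd2 g12 HX b10 b1th x0 below above.
have th0 : 0 < theta by exact: lt_trans b1th.
have a0 : 0 <= theta * (1 + b1) by rewrite mulr_ge0 ?addr_ge0// ltW.
have c0 : 0 <= theta - b1 by rewrite subr_ge0 ltW.
have hb1 := distortion_bump gd1; have hb2 := distortion_bump gd2.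
have hbm := concave_bump_min (concave_bumpZ a0 hb1) (concave_bumpZ c0 hb2).
have EX := expectation_fin_of_risk X0 gd2 HX.
have dX : deviation (excess g2) X \is a fin_num by rewrite -distortion_risk_fin.
have h10 t := bump_survival_ge0 X t hb1.
have h20 t := bump_survival_ge0 X t hb2.
have mh1 := measurable_bump_survival X hb1.
have mh2 := measurable_bump_survival X hb2.
have mm := measurable_bump_survival X hbm.
have sub (A : set R) g : measurable A -> (forall t, A t ->
      0 <= excess g (survival X t) <= excess g2 (survival X t)) ->
    measurable_fun [set: R] (fun t => excess g (survival X t)) ->
    (\int[mu]_(t in A) (excess g (survival X t))%:E)%E \is a fin_num.
  move=> mA gg2 mg; rewrite ge0_fin_numE; last first.
    by apply: integral_ge0 => t /gg2/andP[]; rewrite lee_fin.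
  apply: le_lt_trans (_ : deviation (excess g2) X < +oo)%E; last first.
    by rewrite -ge0_fin_numE//; exact: deviation_ge0.
  apply: (@le_trans _ _ (\int[mu]_(t in A) (excess g2 (survival X t))%:E)%E).
    apply: ge0_le_integral => //.
    + by move=> t /gg2/andP[]; rewrite lee_fin.
    + exact/measurable_EFinP/measurable_funTS.
    + exact/measurable_EFinP/measurable_funTS.
    + by move=> t /gg2/andP[]; rewrite lee_fin.
  apply: ge0_subset_integral => //=; first exact/measurable_EFinP.
  by move=> t _; rewrite lee_fin.
have EY1 : 'E_P[deductible x \o X]%E \is a fin_num.
  rewrite expectation_deductible.
  have S0 t : (0 <= (survival X t)%:E)%E.
    by rewrite lee_fin; case/andP: (survival_itv X t).
  have mS : measurable_fun [set: R] (fun t => (survival X t)%:E).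
    by apply/measurable_EFinP; exact: measurable_survival.
  rewrite ge0_fin_numE; last exact: integral_ge0.
  apply: le_lt_trans (_ : 'E_P[deductible 0 \o X] < +oo)%E.
    rewrite expectation_deductible; apply: ge0_subset_integral => //.
      exact: measurable_funTS.
    by move=> t /=; rewrite !in_itv/= !andbT; exact: le_trans.
  by rewrite -(expectation_ae_deductible0 X0) ltey_eq EX.
apply: pareto_optimal_deviation => //.
- by apply: filterE => w /=; rewrite addrC subrK.
- apply: expectation_fin_num.
  by apply: rpredB; [exact: expectation_Lfun|exact: (expectation_Lfun EY1)].
- rewrite deviation_deductible//; apply: sub => // t _.
  by rewrite h10 lerB// g12// in_itv/= survival_itv.
- by rewrite deviation_retained//; apply: sub => // t _; rewrite h20 lexx.
rewrite deviation_deductible// deviation_retained// addeC.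
rewrite [leRHS]/deviation (@ge0_integral_split _ x); last 2 first.
- exact/measurable_EFinP.
- by move=> t; rewrite lee_fin (bump_survival_ge0 X t hbm).
apply: leeD.
  rewrite -ge0_integralZl_EFin//; last 2 first.
  - by move=> t _; rewrite lee_fin.
  - exact/measurable_EFinP/measurable_funTS.
  apply: eqW; apply: eq_integral => t.
  by rewrite inE/= in_itv/= => /below tx; rewrite -EFinM min_r.
rewrite -ge0_integralZl_EFin//; last 2 first.
- by move=> t _; rewrite lee_fin.
- exact/measurable_EFinP/measurable_funTS.
rewrite -[leRHS]integral_itv_obnd_cbnd; last first.
  exact/measurable_EFinP/measurable_funTS.
rewrite -[leLHS]integral_itv_obnd_cbnd; last first.
  apply/measurable_EFinP; apply: measurable_funM => //.
  exact: measurable_funTS.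
apply: eqW; apply: eq_integral => t.
by rewrite inE/= in_itv/= andbT => /above tx; rewrite -EFinM min_l.
Qed.

Lemma pareto_no_insurance g1 g2 (b1 theta : R) X :
  {ae P, forall w, 0 <= X w} ->
  concave_distortion g1 -> concave_distortion g2 ->
  distortion_risk g2 X \is a fin_num -> 0 < b1 -> b1 < theta ->
  (forall t, (theta - b1) * excess g2 (survival X t) <=
             theta * (1 + b1) * excess g1 (survival X t)) ->
  pareto_optimal (V1 g1 b1 theta) (V2 g2 theta) X
    (cst 0 \o X) (X \- (cst 0 \o X)).
Proof.
move=> X0 gd1 gd2 HX b10 b1th all.
have hb1 := distortion_bump gd1; have hb2 := distortion_bump gd2.
have EX := expectation_fin_of_risk X0 gd2 HX.
have dX : deviation (excess g2) X \is a fin_num by rewrite -distortion_risk_fin.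
have d1 : deviation (P := P) (excess g1) (cst 0 \o X) = 0%E.
  rewrite /deviation; apply: integral0_eq => t _; rewrite survival_cst0.
  by case: hb1 => H0 H1 _; case: ifP; rewrite ?H0 ?H1.
have d2 : deviation (P := P) (excess g2) (X \- (cst 0 \o X)) =
    deviation (excess g2) X.
  by apply: eq_integral => t _; rewrite survival_subr0.
have EY1 : ('E_P[(cst 0 \o X)%R])%E \is a fin_num.
  by rewrite (expectation_cst P 0).
apply: pareto_optimal_deviation => //.
- by apply: filterE => w /=; rewrite addrC subrK.
- apply: expectation_fin_num.
  by apply: rpredB; [exact: expectation_Lfun|exact: (expectation_Lfun EY1)].
- by rewrite d1.
- by rewrite d2.
rewrite d1 d2 mule0 add0e /deviation -ge0_integralZl_EFin//; last 3 first.
- by move=> t _; rewrite lee_fin (bump_survival_ge0 X t hb2).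
- by apply/measurable_EFinP; exact: measurable_bump_survival hb2.
- by rewrite subr_ge0 ltW.
apply: eqW; apply: eq_integral => t _.
by rewrite -EFinM min_r.
Qed.

End layers.

Theorem proposition1 (disp : measure_display) (T : measurableType disp)
    (R : realType) (P : probability T R) (X : {RV P >-> R})
    (g1 g2 : R -> R) (b1 theta : R)
    (X_ge0 : {ae P, forall w, 0 <= X w})
    (g1_dist : concave_distortion g1) (g2_dist : concave_distortion g2)
    (g1_le_g2 : {in `[0, 1], forall p, g1 p <= g2 p})
    (g2_gt : {in `]0, 1[, forall p, p < g2 p})
    (HX_fin : distortion_risk g2 X \is a fin_num)
    (b1_gt0 : 0 < b1) (b1_lt_theta : b1 < theta)
    (ratio_incr : {in `]0, 1[ &, forall p q, p <= q ->
       (g1 p - p) / (g2 p - p) <= (g1 q - q) / (g2 q - q)}) :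
  let D := [set t : R | [/\ 0 <= t, 0 < survival X t < 1 &
    (g1 (survival X t) - survival X t) / (g2 (survival X t) - survival X t)
      <= (theta - b1) / (theta * (1 + b1))]] in
  (D !=set0 ->
     optimal_indemnity (V1 g1 b1 theta) (V2 g2 theta) X (deductible (inf D))) /\
  (D = set0 -> optimal_indemnity (V1 g1 b1 theta) (V2 g2 theta) X (cst 0)).
Proof.
move=> D.
have th0 : 0 < theta by exact: lt_trans b1_lt_theta.
have a0 : 0 < theta * (1 + b1) by rewrite mulr_gt0// addr_gt0.
have [h10 h11 _] := distortion_bump g1_dist.
have [h20 h21 _] := distortion_bump g2_dist.
have S_itv t : 0 <= survival X t <= 1 := survival_itv X t.
have ratioE p : 0 < p < 1 ->
    ((g1 p - p) / (g2 p - p) <= (theta - b1) / (theta * (1 + b1))) =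
    (theta * (1 + b1) * excess g1 p <= (theta - b1) * excess g2 p).
  move=> p01; have e2 : 0 < g2 p - p by rewrite subr_gt0 g2_gt// in_itv.
  by rewrite ler_pdivrMr// mulrAC ler_pdivlMr// [X in X <= _]mulrC.
(* Where the survival probability is 0 or 1 both sides vanish; elsewhere the
   ratio exceeds the threshold. *)
have notD t : ~ D t -> (theta - b1) * excess g2 (survival X t) <=
                       theta * (1 + b1) * excess g1 (survival X t).
  move=> Dt; have [t0|t0] := ltP t 0.
    by rewrite (survival_neg X_ge0 t0) h11 h21 !mulr0.
  have [->|S0] := eqVneq (survival X t) 0; first by rewrite h10 h20 !mulr0.
  have [->|S1] := eqVneq (survival X t) 1; first by rewrite h11 h21 !mulr0.
  have S01 : 0 < survival X t < 1 by rewrite !lt_neqAle eq_sym S0 S1/= S_itv.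
  apply/ltW; rewrite ltNge -ratioE//; apply/negP => Sr; apply: Dt.
  by split.
(* Once in [D] the insurer stays the cheaper holder, by monotonicity. *)
have afterD s t : D s -> s < t -> theta * (1 + b1) * excess g1 (survival X t) <=
                                  (theta - b1) * excess g2 (survival X t).
  move=> [s0 S01 Sr] /ltW/(survival_le X) Sts.
  have [->|S0] := eqVneq (survival X t) 0; first by rewrite h10 h20 !mulr0.
  have S01t : 0 < survival X t < 1.
    have /andP[St0 _] := S_itv t; have /andP[_ Ss1] := S01.
    by rewrite lt_neqAle eq_sym S0 St0 (le_lt_trans Sts Ss1).
  rewrite -ratioE//; apply: le_trans Sr.
  by apply: ratio_incr => //; rewrite in_itv.
split=> [D0|D0].
- have infD0 : 0 <= inf D by apply: lb_le_inf => // t [].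
  split; first by rewrite /= /deductible sub0r max_r// oppr_le0.
  apply: pareto_deductible => // t tD.
    apply: notD => Dt; move: tD; rewrite ltNge => /negP; apply.
    by apply: ge_inf => //; exists 0 => ? [].
  by have [s Ds st] := inf_lt D0 tD; exact: afterD Ds st.
- split => //; apply: pareto_no_insurance => // t.
  by apply: notD; rewrite D0.
Qed.
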